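(* Let $n=\prod_{i=1}^r p_i^{k_i}$, where $p_1,\dots,p_r$ are distinct primes and $k_i\ge 1$. Then $C_n\times C_n$ is the unique isomorphism type of groups of central type of order $n^2$ if and only if $n$ is square-free (that is, $k_i=1$ for all $i$) and $$p_j\not\equiv \pm 1 \pmod{p_i}\qquad \text{for all } 1\le i,j\le r.$$
   Context: $C_n$ denotes the cyclic group of order $n$. For a finite group $G$ and a 2-cocycle $f\in Z^2(G,\mathbb{C}^* )$ (trivial action of $G$ on $\mathbb{C}^*$), the twisted group algebra $\mathbb{C}^fG$ is the $\mathbb{C}$-algebra with basis $\{u_g\}_{g\in G}$ and multiplication $u_{g}u_{h}=f(g,h)u_{gh}$. The cocycle $f$ is non-degenerate if $\mathbb{C}^fG$ is isomorphic to a matrix algebra over $\mathbb{C}$ (i.e. is simple). A finite group $G$ is of central type if it admits a non-degenerate 2-cocycle in $Z^2(G,\mathbb{C}^* )$. *)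

(* Defs.v *)
From HB Require Import structures.
From mathcomp Require Import all_boot all_order all_fingroup all_algebra.
From mathcomp Require Import complex reals.

Set Implicit Arguments.
Unset Strict Implicit.
Unset Printing Implicit Defensive.

Import GRing.Theory.
Local Open Scope ring_scope.

(* Z^2(gT, F^* ) for the trivial action of gT on F^*; cocycles are not assumed
   to be normalized. *)
Record cocycle2 (F : fieldType) (gT : finGroupType) := Cocycle2 {
  cocycle2_fun :> gT -> gT -> F;
  cocycle2_neq0 : forall g h, cocycle2_fun g h != 0;
  cocycle2P : forall g h k,
    cocycle2_fun g h * cocycle2_fun (g * h)%g k
    = cocycle2_fun h k * cocycle2_fun g (h * k)%g }.

Definition twisted_group_algebra (F : fieldType) (gT : finGroupType)
  (f : cocycle2 F gT) : Type := {ffun gT -> F^o}.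

Section TwistedGroupAlgebra.
Variables (F : fieldType) (gT : finGroupType) (f : cocycle2 F gT).
Local Notation A := (twisted_group_algebra f).

HB.instance Definition _ := GRing.Lmodule.on A.

Definition tga_basis (g : gT) : A := [ffun x => (x == g)%:R].
Local Notation u := tga_basis.

Lemma tga_sum_basis (a : A) : a = \sum_g a g *: u g.
Proof.
apply/ffunP => x; rewrite sum_ffunE (bigD1 x) //= !ffunE eqxx big1 ?addr0.
  by rewrite -[RHS]/(_ * _) mulr1.
by move=> g /negPf gx; rewrite !ffunE eq_sym gx -[LHS]/(_ * _) mulr0.
Qed.

Definition tga_mul (a b : A) : A :=
  \sum_g \sum_h (a g * b h * f g h) *: u (g * h)%g.

(* The relation f(1,1) f(1,h) = f(1,h) f(1,h) shows that u_1 / f(1,1), and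
   not u_1, is the unit. *)
Definition tga_one : A := (f 1%g 1%g)^-1 *: u 1%g.

Fact tga_mulDl : left_distributive tga_mul +%R.
Proof.
move=> a b c; rewrite /tga_mul -big_split; apply: eq_bigr => g _ /=.
rewrite -big_split; apply: eq_bigr => h _ /=.
by rewrite !ffunE !mulrDl scalerDl.
Qed.

Fact tga_mulDr : right_distributive tga_mul +%R.
Proof.
move=> a b c; rewrite /tga_mul -big_split; apply: eq_bigr => g _ /=.
rewrite -big_split; apply: eq_bigr => h _ /=.
by rewrite !ffunE mulrDr mulrDl scalerDl.
Qed.

Fact tga_scaleAl (k : F) (a b : A) : k *: tga_mul a b = tga_mul (k *: a) b.
Proof.
rewrite /tga_mul scaler_sumr; apply: eq_bigr => g _.
rewrite scaler_sumr; apply: eq_bigr => h _.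
by rewrite !ffunE scalerA -[k *: a g]/(k * a g) !mulrA.
Qed.

Fact tga_scaleAr (k : F) (a b : A) : k *: tga_mul a b = tga_mul a (k *: b).
Proof.
rewrite /tga_mul scaler_sumr; apply: eq_bigr => g _.
rewrite scaler_sumr; apply: eq_bigr => h _.
by rewrite !ffunE scalerA -[k *: b h]/(k * b h) !mulrA [a g * k]mulrC.
Qed.

Fact tga_mul_suml (I : finType) (a : I -> A) b :
  tga_mul (\sum_i a i) b = \sum_i tga_mul (a i) b.
Proof.
apply: (big_morph (fun x => tga_mul x b)) => [x y|]; first exact: tga_mulDl.
by rewrite -[X in tga_mul X b](scale0r (0 : A)) -tga_scaleAl scale0r.
Qed.

Fact tga_mul_sumr (I : finType) (a : I -> A) b :
  tga_mul b (\sum_i a i) = \sum_i tga_mul b (a i).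
Proof.
apply: (big_morph (tga_mul b)) => [x y|]; first exact: tga_mulDr.
by rewrite -[X in tga_mul b X](scale0r (0 : A)) -tga_scaleAr scale0r.
Qed.

Fact tga_mul_basis g h : tga_mul (u g) (u h) = f g h *: u (g * h)%g.
Proof.
rewrite /tga_mul (bigD1 g) //= (bigD1 h) //= !ffunE !eqxx !mul1r.
rewrite [X in _ + X + _]big1 => [|k /negPf kh]; last first.
  by rewrite !ffunE kh mulr0 mul0r scale0r.
rewrite addr0 big1 ?addr0 // => k /negPf kg; apply: big1 => l _.
by rewrite !ffunE kg !mul0r scale0r.
Qed.

Fact tga_mulA : associative tga_mul.
Proof.
move=> a b c; transitivity (\sum_g \sum_h \sum_k
  tga_mul (a g *: u g) (tga_mul (b h *: u h) (c k *: u k))).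
  rewrite {1}[a]tga_sum_basis tga_mul_suml; apply: eq_bigr => g _.
  rewrite {1}[b]tga_sum_basis (tga_mul_suml _ c) tga_mul_sumr.
  apply: eq_bigr => h _.
  by rewrite {1}[c]tga_sum_basis (tga_mul_sumr _ (b h *: u h)) tga_mul_sumr.
symmetry; rewrite {1}[a]tga_sum_basis (tga_mul_suml _ b) tga_mul_suml.
apply: eq_bigr => g _.
rewrite {1}[b]tga_sum_basis (tga_mul_sumr _ (a g *: u g)) tga_mul_suml.
apply: eq_bigr => h _; rewrite {1}[c]tga_sum_basis tga_mul_sumr.
apply: eq_bigr => k _; rewrite -!(tga_scaleAl, tga_scaleAr) !tga_mul_basis.
rewrite -!(tga_scaleAl, tga_scaleAr) !tga_mul_basis !scalerA -!mulrA.
by rewrite cocycle2P mulgA mulrCA [c k * _]mulrCA.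
Qed.

Fact tga_mul1r : left_id tga_one tga_mul.
Proof.
move=> a; rewrite {1}[a]tga_sum_basis tga_mul_sumr [RHS]tga_sum_basis.
apply: eq_bigr => h _; rewrite -tga_scaleAr -tga_scaleAl tga_mul_basis mul1g.
have := cocycle2P f 1%g 1%g h; rewrite !mul1g => /(mulIf (cocycle2_neq0 _ _ _)).
by move=> <-; rewrite [_^-1 *: _]scalerA mulVf ?scale1r ?cocycle2_neq0.
Qed.

Fact tga_mulr1 : right_id tga_one tga_mul.
Proof.
move=> a; rewrite {1}[a]tga_sum_basis tga_mul_suml [RHS]tga_sum_basis.
apply: eq_bigr => h _; rewrite -tga_scaleAl -tga_scaleAr tga_mul_basis mulg1.
have := cocycle2P f h 1%g 1%g; rewrite !mulg1 => /(mulIf (cocycle2_neq0 _ _ _)).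
by move=> ->; rewrite [_^-1 *: _]scalerA mulVf ?scale1r ?cocycle2_neq0.
Qed.

Fact tga_one_neq0 : tga_one != 0.
Proof.
apply/eqP => /ffunP /(_ 1%g); rewrite !ffunE eqxx -[LHS]/(_ * _) mulr1.
by apply/eqP; rewrite invr_eq0 cocycle2_neq0.
Qed.

HB.instance Definition _ := GRing.Zmodule_isNzRing.Build A
  tga_mulA tga_mul1r tga_mulr1 tga_mulDl tga_mulDr tga_one_neq0.
HB.instance Definition _ := GRing.Lmodule_isLalgebra.Build F A tga_scaleAl.
HB.instance Definition _ := GRing.Lalgebra_isAlgebra.Build F A tga_scaleAr.

Lemma tga_basisM g h : (u g * u h : A) = f g h *: u (g * h)%g.
Proof. exact: tga_mul_basis. Qed.

End TwistedGroupAlgebra.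

Definition nondegenerate_cocycle (F : fieldType) (gT : finGroupType)
    (f : cocycle2 F gT) : Prop :=
  exists (m : nat) (phi : {lrmorphism twisted_group_algebra f -> 'M[F]_m.+1}),
    bijective phi.

(* The complex numbers are R[i], for R a model of the real numbers. *)
Definition central_type (R : realType) (gT : finGroupType) : Prop :=
  exists f : cocycle2 (complex R) gT, nondegenerate_cocycle f.

(* The additive group of integers modulo n, for n > 0; unlike 'Z_n, it is the
   trivial group when n = 1. *)
Definition cyclic_group (n : nat) : finGroupType := 'I_n.-1.+1.

Definition cyclic_square (n : nat) : finGroupType :=
  (cyclic_group n * cyclic_group n)%type.

(* Main.v *)
Require Import Defs.
From HB Require Import structures.
From mathcomp Require Import all_boot all_order all_fingroup all_algebra.
From mathcomp Require Import all_solvable separable cyclotomic finfield.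
From mathcomp Require Import mxtens complex reals ring.

Set Implicit Arguments.
Unset Strict Implicit.
Unset Printing Implicit Defensive.

Import Order.TTheory GRing.Theory Num.Theory.
Local Open Scope ring_scope.

(** A projective representation of degree m of a group of order m^2 whose
    matrices have trace 0 off the identity is linearly independent, by the
    trace form, hence spans the full matrix algebra: its cocycle is
    non-degenerate ([tfp_central_type]).  All groups of central type needed
    below come from such representations.

    If n is not square-free, or if q = 1 or -1 modulo p for prime divisors p, q
    of n, another group of central type of order n^2 exists.
    - If p^2 divides n, the square of C_p x C_(n/p) has exponent n/p.
    - If p divides q - 1 or q + 1, then SL_2(q) has an element S of order p
      ([SL2_elt_prime_order]).  For q odd, the Heisenberg representation of
      F_q^2 can be normalised so that its cocycle depends only on the
      determinant form, which S preserves; the representation thus extends to a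
      semidirect product with C_p x C_p, the first factor acting through S
      ([tfp_semidirect]).  The result is not abelian, and a direct product
      with the square of C_(n/(p q)) has order n^2.  The case q = 2 forces
      p = 3, where the roles of p and q can be exchanged.

    Conversely, let n be square-free without such congruences, and let G be a
    group of central type of order n^2.  A prime q dividing n, q <> p, divides
    neither p - 1 nor p + 1, so a q-group acts trivially on a group of order
    p^2.  Each Sylow subgroup is thus central in its normaliser; by transfer the
    derived subgroup of G has order prime to every p, that is, G is abelian
    ([arith_abelian]).  For abelian G the ratio f(x, y) / f(y, x) is a
    bicharacter, non-degenerate when the twisted group algebra has trivial
    centre.  A cyclic Hall subgroup lies in its radical
    ([nondegenerate_cyclic_Hall]), so the Sylow subgroups are not cyclic, G has
    exponent n, and G is isomorphic to C_n x C_n. *)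

(** * Projective representations of degree m on groups of order m^2 *)

(** The equality [n1 = n2] is propositional: the dimensions are an order and a
    square of a degree. *)
Lemma mulmx1_eqC (F : fieldType) n1 n2 (A : 'M[F]_(n1, n2))
    (B : 'M[F]_(n2, n1)) :
  n1 = n2 -> A *m B = 1%:M -> B *m A = 1%:M.
Proof. by move=> e; subst n2; apply: mulmx1C. Qed.

Lemma mx_central_scalar (R : comNzRingType) m (B : 'M[R]_m.+1) :
  (forall A, A *m B = B *m A) -> exists c, B = c%:M.
Proof.
move=> cB; exists (B 0 0); apply/matrixP => i j; rewrite mxE.
have := cB (delta_mx 0 i) => /matrixP /(_ 0 j).
rewrite !mxE (bigD1 i) //= mxE !eqxx mul1r big1 => [|k nki]; last first.
  by rewrite mxE eqxx /= (negPf nki) mul0r.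
rewrite addr0 (bigD1 0) //= mxE eqxx /= big1 => [->|k nki].
  by rewrite addr0 eq_sym mulr_natr.
by rewrite mxE (negPf nki) mulr0.
Qed.

Section ProjRep.
Variables (F : numFieldType) (gT : finGroupType) (m : nat).

(** The trace condition makes the matrices orthogonal for the form
    (A, B) |-> tr (A^-1 B), and the cardinality condition makes them a basis. *)
Record tracefree_projrep (f : gT -> gT -> F) (rho : gT -> 'M[F]_m) : Prop := {
  tfp_unit : forall g, rho g \in unitmx;
  tfp_mul : forall g h, rho g *m rho h = f g h *: rho (g * h)%g;
  tfp_tr0 : forall g, g != 1%g -> \tr (rho g) = 0;
  tfp_card : #|gT| = (m ^ 2)%N }.

Variables (f : gT -> gT -> F) (rho : gT -> 'M[F]_m).
Hypothesis np : tracefree_projrep f rho.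

Lemma tfp_dim_gt0 : (0 < m)%N.
Proof.
have := tfp_card np; case: m => // h.
by have := cardG_gt0 [set: gT]; rewrite cardsT h.
Qed.

Lemma tfp_dim_neq0 : m%:R != 0 :> F.
Proof. by rewrite pnatr_eq0 -lt0n tfp_dim_gt0. Qed.

Lemma tfp_neq0 g : rho g != 0.
Proof.
apply/eqP => r0; have := tfp_unit np g.
rewrite unitmxE unitfE r0 -(scale0r (0 : 'M[F]_m)) detZ expr0n.
by rewrite eqn0Ngt tfp_dim_gt0 mul0r eqxx.
Qed.

Lemma tfp_cocycle_neq0 g h : f g h != 0.
Proof.
apply/eqP => f0; have := tfp_mul np g h; rewrite f0 scale0r => r0.
have := tfp_neq0 h; rewrite -[rho h](mulKmx (tfp_unit np g)) r0 mulmx0.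
by rewrite eqxx.
Qed.

(** Associativity of the matrix product, as no [rho g] vanishes. *)
Lemma tfp_cocycleP g h k :
  f g h * f (g * h)%g k = f h k * f g (h * k)%g.
Proof.
apply/eqP; rewrite -subr_eq0.
have := mulmxA (rho g) (rho h) (rho k).
rewrite !(tfp_mul np) -scalemxAl -scalemxAr !(tfp_mul np) !scalerA mulgA.
move/eqP; rewrite eq_sym -subr_eq0 -scalerBl.
by rewrite scaler_eq0 (negPf (tfp_neq0 _)) orbF.
Qed.

Lemma tfp_rho1 : rho 1%g = (f 1%g 1%g)%:M.
Proof.
rewrite -[LHS](mulKmx (tfp_unit np 1%g)) (tfp_mul np) mulg1 -scalemxAr.
by rewrite mulVmx ?(tfp_unit np) // scalemx1.
Qed.

Lemma tfp_tr_invM g h :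
  \tr (invmx (rho g) *m rho h) = (g == h)%:R * m%:R.
Proof.
have [<-|ngh] := eqVneq g h.
  by rewrite mulVmx ?(tfp_unit np) // mxtrace1 mul1r.
rewrite mul0r; apply: (mulfI (tfp_cocycle_neq0 g (g^-1 * h)%g)).
rewrite -mxtraceZ scalemxAr mulr0 -{2}[h](mulKVg g) -(tfp_mul np).
rewrite mulKmx ?(tfp_unit np) // (tfp_tr0 np) //.
by apply: contra ngh => /eqP e; rewrite -[h](mulKVg g) e mulg1.
Qed.

(** The Fourier coefficients of a matrix in the family [rho]. *)
Definition tfp_coef (A : 'M[F]_m) (g : gT) : F :=
  \tr (invmx (rho g) *m A) / m%:R.

Lemma tfp_coef_sum (a : gT -> F) g :
  tfp_coef (\sum_h a h *: rho h) g = a g.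
Proof.
rewrite /tfp_coef mulmx_sumr raddf_sum (bigD1 g) //= big1 => [|h ngh].
  rewrite addr0 -scalemxAr mxtraceZ tfp_tr_invM eqxx mul1r mulfK //.
  exact: tfp_dim_neq0.
by rewrite -scalemxAr mxtraceZ tfp_tr_invM eq_sym (negPf ngh) mul0r mulr0.
Qed.

(** The matrices [P] of the family [rho] and [Q] of its Fourier coefficients
    satisfy [P *m Q = 1] by orthogonality.  Their dimensions #|gT| and m^2
    agree, so [Q *m P = 1], which is Fourier inversion. *)
Lemma tfp_span (A : 'M[F]_m) : A = \sum_g tfp_coef A g *: rho g.
Proof.
pose P := \matrix_(i < #|gT|, k < m * m) mxvec (rho (enum_val i)) 0 k.
pose Q := \matrix_(k < m * m, i < #|gT|)
  (tfp_coef (vec_mx (delta_mx 0 k)) (enum_val i)).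
have coefE (B : 'M[F]_m) i : (mxvec B *m Q) 0 i = tfp_coef B (enum_val i).
  rewrite -{2}[B]mxvecK [in RHS](row_sum_delta (mxvec B)) mxE.
  rewrite linear_sum /tfp_coef mulmx_sumr raddf_sum mulr_suml.
  by apply: eq_bigr => k _; rewrite mxE linearZ /= -scalemxAr mxtraceZ mulrA.
have PQ : P *m Q = 1%:M.
  apply/row_matrixP => i; rewrite row_mul.
  have -> : row i P = mxvec (rho (enum_val i)).
    by apply/rowP => k; rewrite !mxE.
  apply/rowP => j; rewrite coefE !mxE /tfp_coef tfp_tr_invM.
  rewrite mulfK ?tfp_dim_neq0 //.
  by rewrite (inj_eq enum_val_inj) eq_sym.
have QP : Q *m P = 1%:M.
  by apply: mulmx1_eqC PQ; rewrite (tfp_card np) mulnn.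
rewrite -[LHS]mxvecK -[mxvec A]mulmx1 -QP mulmxA mulmx_sum_row linear_sum /=.
rewrite [RHS](reindex (@enum_val gT gT)) /=; last exact/onW_bij/enum_val_bij.
apply: eq_bigr => i _; rewrite coefE linearZ /=; congr (_ *: _).
by rewrite -[RHS]mxvecK; congr vec_mx; apply/rowP => k; rewrite !mxE.
Qed.

End ProjRep.

Section MatrixAlgebra.
Variables (F : numFieldType) (gT : finGroupType) (m : nat).
Variables (f : gT -> gT -> F) (rho : gT -> 'M[F]_m.+1).
Hypothesis np : tracefree_projrep f rho.

Definition tfp_cocycle : cocycle2 F gT :=
  Cocycle2 (tfp_cocycle_neq0 np) (tfp_cocycleP np).
Local Notation A := (twisted_group_algebra tfp_cocycle).

Definition tfp_mor (a : A) : 'M[F]_m.+1 := \sum_g a g *: rho g.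

Lemma tfp_mor_is_linear : linear tfp_mor.
Proof.
move=> c a b; rewrite /tfp_mor scaler_sumr -big_split; apply: eq_bigr => g _.
by rewrite !ffunE /= -[c *: a g]/(c * a g) scalerDl scalerA.
Qed.

HB.instance Definition _ :=
  GRing.isLinear.Build F A 'M[F]_m.+1 *:%R tfp_mor tfp_mor_is_linear.

Lemma tfp_mor_basis g : tfp_mor (tga_basis tfp_cocycle g) = rho g.
Proof.
rewrite /tfp_mor (bigD1 g) //= ffunE eqxx scale1r big1 ?addr0 // => h ngh.
by rewrite ffunE (negPf ngh) scale0r.
Qed.

Lemma tfp_mor_is_monoid_morphism : monoid_morphism tfp_mor.
Proof.
split=> [|a b].
  rewrite [1]/(tga_one tfp_cocycle) linearZ /= tfp_mor_basis (tfp_rho1 np).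
  by rewrite scale_scalar_mx mulVf ?(tfp_cocycle_neq0 np).
rewrite [a * b]/(tga_mul a b) /tga_mul linear_sum mulr_suml.
apply: eq_bigr => g _; rewrite linear_sum mulr_sumr; apply: eq_bigr => h _.
rewrite linearZ /= tfp_mor_basis -[in RHS]scalerAr -[in RHS]scalerAl.
have -> : rho g * rho h = f g h *: rho (g * h)%g by apply: tfp_mul.
rewrite !scalerA; congr (_ *: _).
by rewrite [b h * _]mulrC.
Qed.

HB.instance Definition _ :=
  GRing.isMonoidMorphism.Build A 'M[F]_m.+1 tfp_mor tfp_mor_is_monoid_morphism.

Lemma tfp_mor_bij : bijective tfp_mor.
Proof.
exists (fun B => [ffun g => tfp_coef rho B g] : A) => [a | B].
  by apply/ffunP => g; rewrite ffunE (tfp_coef_sum np).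
by rewrite [RHS](tfp_span np) /tfp_mor; apply: eq_bigr => g _; rewrite ffunE.
Qed.

(** Extending [rho] linearly gives the isomorphism, Fourier coefficients give
    its inverse. *)
Lemma tfp_nondegenerate : nondegenerate_cocycle tfp_cocycle.
Proof.
by exists m, (tfp_mor : {lrmorphism A -> 'M[F]_m.+1}); apply: tfp_mor_bij.
Qed.

End MatrixAlgebra.

Lemma tfp_central_type (R : realType) (gT : finGroupType) m f
    (rho : gT -> 'M[complex R]_m) :
  tracefree_projrep f rho -> central_type R gT.
Proof.
move=> np; have := tfp_dim_gt0 np; case: m rho np => // m rho np _.
by exists (tfp_cocycle np); apply: tfp_nondegenerate.
Qed.

Section Intertwiner.
Variables (F : numFieldType) (gT : finGroupType) (m : nat).
Variables (f : gT -> gT -> F) (rho : gT -> 'M[F]_m).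
Hypothesis np : tracefree_projrep f rho.

(** Commuting with a spanning family means being central. *)
Lemma tfp_schur (B : 'M[F]_m) :
  (forall g, rho g *m B = B *m rho g) -> exists c, B = c%:M.
Proof.
move=> cB; have cA A : A *m B = B *m A.
  rewrite (tfp_span np A) mulmx_suml mulmx_sumr; apply: eq_bigr => g _.
  by rewrite -scalemxAl -scalemxAr cB.
by case: m (tfp_dim_gt0 np) B cA {cB} => // m' _ B; apply: mx_central_scalar.
Qed.

Variable s : gT -> gT.
Hypothesis sM : {morph s : x y / (x * y)%g}.
Hypothesis sf : forall x y, f (s x) (s y) = f x y.

(** The representations [rho] and [rho \o s] have the same cocycle, so the
    averages of [rho v *m M *m invmx (rho (s v))] over [v] intertwine them.
    Linear independence of [rho] makes some average nonzero.  Its left kernel is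
    stable under all matrices because they are spanned by [rho], hence is
    trivial. *)
Lemma tfp_intertwiner :
  exists2 W, W \in unitmx & forall g, rho g *m W = W *m rho (s g).
Proof.
pose W M := \sum_v rho v *m M *m invmx (rho (s v)).
have WP M g : rho g *m W M = W M *m rho (s g).
  rewrite /W mulmx_sumr mulmx_suml [RHS](reindex_inj (mulgI g)) /=.
  apply: eq_bigr => v _; rewrite !mulmxA (tfp_mul np) -2!scalemxAl.
  have -> : rho (s g) = f g v *: (rho (s (g * v)%g) *m invmx (rho (s v))).
    by rewrite scalemxAl -sf sM -(tfp_mul np) mulmxK ?(tfp_unit np).
  by rewrite -scalemxAr mulmxA mulmxKV ?(tfp_unit np).
have [M WM0] : exists M, W M != 0.
  have [//|noM] := boolP [exists ij, W (delta_mx ij.1 ij.2) != 0].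
    by case/existsP=> ij Hij; exists (delta_mx ij.1 ij.2).
  have W0 i j : W (delta_mx i j) = 0.
    by apply/eqP; move: noM; rewrite negb_exists => /forallP /(_ (i, j)) /negPn.
  have c0 j l v : invmx (rho (s v)) j l = 0.
    pose a v := invmx (rho (s v)) j l.
    rewrite -[LHS]/(a v) -(tfp_coef_sum np a v).
    suff -> : \sum_h a h *: rho h = 0 by rewrite /tfp_coef mulmx0 raddf0 mul0r.
    apply/matrixP => k i; transitivity (W (delta_mx i j) k l).
      rewrite /W !summxE; apply: eq_bigr => h _.
      rewrite -(mul_delta_mx (0 : 'I_1)) mulmxA -colE -mulmxA -rowE.
      by rewrite !mxE big_ord1 !mxE mulrC.
    by rewrite W0 !mxE.
  pose i0 := Ordinal (tfp_dim_gt0 np); have := tfp_unit np (s 1%g).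
  rewrite -unitmx_inv unitmxE unitfE (_ : invmx _ = 0); last first.
    by apply/matrixP => i j; rewrite c0 mxE.
  by rewrite (expand_det_row _ i0) big1 ?eqxx // => j _; rewrite mxE mul0r.
exists (W M); last exact: WP.
have WA A : exists A', A *m W M = W M *m A'.
  exists (\sum_g tfp_coef rho A g *: rho (s g)).
  rewrite {1}(tfp_span np A) mulmx_suml mulmx_sumr; apply: eq_bigr => g _.
  by rewrite -scalemxAl -scalemxAr WP.
rewrite -row_free_unit -kermx_eq0; apply: contraR WM0 => /rowV0Pn[u].
move=> /sub_kermxP uW /eqP/rowP u_neq0.
have [k uk] : exists k, u 0 k != 0.
  case: (pickP (fun k => u 0 k != 0)) => [k uk|u0]; first by exists k.
  by case: u_neq0 => k; rewrite mxE; apply/eqP/negbFE/u0.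
apply/eqP/row_matrixP => j; rewrite row0 rowE.
have -> : delta_mx 0 j = u *m ((u 0 k)^-1 *: delta_mx k j).
  rewrite -[delta_mx k j](mul_delta_mx (0 : 'I_1)) scalemxAl mulmxA.
  rewrite -scalemxAr -colE.
  rewrite [X in X *m _](_ : _ = 1%:M) ?mul1mx //.
  by apply/matrixP => a b; rewrite !ord1 !mxE mulVf.
have [A' e] := WA ((u 0 k)^-1 *: delta_mx k j).
by rewrite -mulmxA e mulmxA uW mul0mx.
Qed.

End Intertwiner.

(** * Semidirect and direct products *)

Lemma mxtrace_tens (R : comPzRingType) m n (A : 'M[R]_m) (B : 'M[R]_n) :
  \tr (A *t B) = \tr A * \tr B.
Proof.
by rewrite /mxtrace mulr_sum; apply: eq_bigr => k _; rewrite mxE.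
Qed.

Lemma tensmxZ (R : comPzRingType) m n (a b : R) (A : 'M[R]_m) (B : 'M[R]_n) :
  (a *: A) *t (b *: B) = (a * b) *: (A *t B).
Proof. by apply/matrixP => i j; rewrite !mxE mulrACA. Qed.

(** The maps [pK] and [pV] present gT as a semidirect product, [s] being the
    right action of K on V.  This form covers both the library's external
    semidirect product and, for trivial [s], the cartesian product. *)
Section Semidirect.
Variables (F : numFieldType) (gT K V : finGroupType).
Variables (pK : gT -> K) (pV : gT -> V) (s : K -> V -> V).
Hypothesis pKM : {morph pK : x y / (x * y)%g}.
Hypothesis pVM : forall x y, pV (x * y)%g = (s (pK y) (pV x) * pV y)%g.
Hypothesis p_inj : forall x, pK x = 1%g -> pV x = 1%g -> x = 1%g.
Hypothesis card_gT : #|gT| = (#|K| * #|V|)%N.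
Hypothesis sM : forall a, {morph s a : x y / (x * y)%g}.
Hypothesis sA : forall a b x, s (a * b)%g x = s b (s a x).
Hypothesis s1 : forall x, s 1%g x = x.

Variables (l m : nat) (fK : K -> K -> F) (fV : V -> V -> F).
Variables (tau : K -> 'M[F]_l) (rho : V -> 'M[F]_m).
Hypothesis npK : tracefree_projrep fK tau.
Hypothesis npV : tracefree_projrep fV rho.
Hypothesis sf : forall a x y, fV (s a x) (s a y) = fV x y.

(** For each [a : K] an intertwiner [W a] implements the action of [a] on V; by
    Schur's lemma [W] is itself projective.  Tensoring with [tau] kills the
    trace of every element outside V. *)
Lemma tfp_semidirect :
  exists f (sigma : gT -> 'M[F]_(m * l)), tracefree_projrep f sigma.
Proof.
have [W uW WP] := fin_all_exists2 (fun a => tfp_intertwiner npV (sM a) (sf a)).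
have /fin_all_exists [c cP] : forall ab : K * K, exists c,
    W ab.1 *m W ab.2 = c *: W (ab.1 * ab.2)%g.
  case=> a b /=.
  have [x|c cE] := tfp_schur npV (B := W a *m W b *m invmx (W (a * b)%g)).
    rewrite !mulmxA WP -[X in X *m _ = _]mulmxA WP -sA.
    rewrite mulmxA -!mulmxA; do 2!congr (_ *m _).
    apply: (canRL (mulKmx (uW (a * b)%g))).
    by rewrite mulmxA -WP mulmxK // uW.
  by exists c; rewrite -[LHS](mulmxKV (uW (a * b)%g)) cE mul_scalar_mx.
pose f x y := c (pK x, pK y) * fV (s (pK y) (pV x)) (pV y) * fK (pK x) (pK y).
exists f, (fun x => (W (pK x) *m rho (pV x)) *t tau (pK x)); split.
- move=> x; apply: tensmx_unit.
  - by rewrite -lt0n (tfp_dim_gt0 npV).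
  - by rewrite -lt0n (tfp_dim_gt0 npK).
  - by rewrite unitmx_mul uW (tfp_unit npV).
  - exact: tfp_unit npK _.
- move=> x y; rewrite tensmx_mul (tfp_mul npK) -pKM.
  rewrite -(mulmxA (W _)) (mulmxA (rho _)) WP.
  rewrite -(mulmxA (W (pK y))) (tfp_mul npV).
  rewrite mulmxA (cP (pK x, pK y)) /= -pKM -pVM.
  by rewrite -scalemxAl -scalemxAr scalerA tensmxZ.
- move=> x xn1; rewrite mxtrace_tens.
  have [Kx1|Kxn1] := eqVneq (pK x) 1%g; last by rewrite (tfp_tr0 npK) ?mulr0.
  rewrite Kx1; have [y|c1 ->] := tfp_schur npV (B := W 1%g).
    by rewrite WP s1.
  rewrite mul_scalar_mx mxtraceZ (tfp_tr0 npV) ?mulr0 ?mul0r //.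
  by apply: contra xn1 => /eqP Vx1; rewrite (p_inj Kx1 Vx1).
- by rewrite card_gT (tfp_card npK) (tfp_card npV) mulnC expnMn.
Qed.

End Semidirect.

Lemma tfp_prod (F : numFieldType) (G1 G2 : finGroupType) m1 m2 f1 f2
    (rho1 : G1 -> 'M[F]_m1) (rho2 : G2 -> 'M[F]_m2) :
    tracefree_projrep f1 rho1 -> tracefree_projrep f2 rho2 ->
  exists f (sigma : (G1 * G2)%type -> 'M[F]_(m1 * m2)),
    tracefree_projrep f sigma.
Proof.
move=> np1 np2.
apply: (@tfp_semidirect _ _ _ _ snd fst (fun=> id)
  _ _ _ _ _ _ _ _ _ _ _ _ _ np2 np1) => //.
- by case=> x1 x2 /= -> ->.
- by rewrite card_prod mulnC.
Qed.

(** * The Heisenberg representation *)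

Lemma prim_root_exists (F : numClosedFieldType) n :
  (0 < n)%N -> exists z : F, n.-primitive_root z.
Proof.
move=> n_gt0; have [r] := closed_field_poly_normal ('X^n - 1 : {poly F}).
rewrite lead_coefXnsubC // scale1r => Er.
have /hasP[z _ zP] : has n.-primitive_root r; last by exists z.
apply: has_prim_root => //.
- by apply/allP => z; rewrite -root_prod_XsubC -Er.
- by rewrite -separable_prod_XsubC -Er separable_Xn_sub_1 // pnatr_eq0 -lt0n.
- by rewrite -ltnS -(size_prod_XsubC r id) -Er size_XnsubC.
Qed.

(** The group acts on functions on A by translating by [pa] and multiplying by
    the character [chi] of [pb].  The scalar factor [chi (c * (pa x * pb x))]
    changes the cocycle by a coboundary: with c = 0 the formula needs no
    division by 2, and with c = 1/2 the exponent of the cocycle becomes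
    alternating. *)
Section Heisenberg.
Variables (F : numFieldType) (A : finComNzRingType) (chi : A -> F).
Hypothesis chi0 : chi 0 = 1.
Hypothesis chiD : forall x y, chi (x + y) = chi x * chi y.
Hypothesis chi_nd : forall b, b != 0 -> exists i, chi (b * i) != 1.

Lemma chi_neq0 x : chi x != 0.
Proof.
apply/eqP => cx0; have /eqP := chiD x (- x).
by rewrite subrr chi0 cx0 mul0r oner_eq0.
Qed.

(** Translating the summation variable by [i] with [chi (b * i) != 1] multiplies
    the sum by that factor. *)
Lemma chi_sum b : b != 0 -> \sum_x chi (b * x) = 0.
Proof.
move=> /chi_nd[i ci]; apply: (mulIf (_ : chi (b * i) - 1 != 0)).
  by rewrite subr_eq0.
rewrite mul0r mulrBr mulr1 mulr_suml; apply/eqP; rewrite subr_eq0; apply/eqP.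
rewrite [RHS](reindex_inj (addIr i)) /=.
by apply: eq_bigr => x _; rewrite mulrDr chiD.
Qed.

Variables (gT : finGroupType) (pa pb : gT -> A) (c : A).
Hypothesis paM : forall x y, pa (x * y)%g = pa x + pa y.
Hypothesis pbM : forall x y, pb (x * y)%g = pb x + pb y.
Hypothesis p_inj : forall x, pa x = 0 -> pb x = 0 -> x = 1%g.
Hypothesis card_gT : #|gT| = (#|A| ^ 2)%N.

Definition heisenberg_cocycle x y :=
  chi (pa x * pb y - c * (pa x * pb y + pb x * pa y)).

Definition heisenberg (x : gT) : 'M[F]_#|A| :=
  \matrix_(i, j) ((enum_val j == enum_val i + pa x)%:R
                  * chi (pb x * enum_val i + c * (pa x * pb x))).

Lemma heisenberg_mul x y :
  heisenberg x *m heisenberg y = heisenberg_cocycle x y *: heisenberg (x * y)%g.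
Proof.
apply/matrixP => i k; rewrite !mxE (bigD1 (enum_rank (enum_val i + pa x))) //=.
rewrite big1 => [|j nj]; last first.
  rewrite !mxE (_ : _ == _ = false) ?mul0r //.
  by apply: contraNF nj => /eqP <-; rewrite enum_valK.
rewrite addr0 !mxE !enum_rankK eqxx mul1r paM addrA mulrCA [RHS]mulrCA.
congr (_ * _); rewrite /heisenberg_cocycle -!chiD pbM; congr (chi _).
ring.
Qed.

Lemma heisenberg_tfp : tracefree_projrep heisenberg_cocycle heisenberg.
Proof.
have one1 : heisenberg 1%g = 1%:M.
  have pa1 : pa 1%g = 0 by apply: (addIr (pa 1%g)); rewrite -paM mulg1 add0r.
  have pb1 : pb 1%g = 0 by apply: (addIr (pb 1%g)); rewrite -pbM mulg1 add0r.
  apply/matrixP => i j; rewrite !mxE pa1 pb1 !mul0r !mulr0 !addr0 chi0 mulr1.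
  by rewrite (inj_eq enum_val_inj) eq_sym.
split=> [x||x xn1|//]; last 2 first.
- exact: heisenberg_mul.
- rewrite /mxtrace.
  under eq_bigr => i _ do rewrite mxE eq_sym -subr_eq0 addrC addKr chiD.
  have [a0|an0] := eqVneq (pa x) 0; last first.
    by rewrite big1 // => i _; rewrite mul0r.
  rewrite a0 mul0r mulr0 chi0.
  under eq_bigr => i _ do rewrite mul1r mulr1.
  rewrite -(reindex (@enum_val A A) (P := xpredT)
    (F := fun y => chi (pb x * y))) /=; last exact/onW_bij/enum_val_bij.
  apply: chi_sum; apply: contra xn1 => /eqP b0; exact/eqP/p_inj.
have := heisenberg_mul x x^-1%g; rewrite mulgV one1 => e.
have /mulmx1_unit[] // : heisenberg x *m
  ((heisenberg_cocycle x x^-1%g)^-1 *: heisenberg x^-1%g) = 1%:M.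
by rewrite -scalemxAr e scalerA mulVf ?scale1r ?chi_neq0.
Qed.

End Heisenberg.

Lemma det_mx22 (R : comNzRingType) (S : 'M[R]_2) :
  \det S = S 0 0 * S 1 1 - S 0 1 * S 1 0.
Proof.
have l0 : lift 0 0 = 1 :> 'I_2 by apply/val_inj.
have l1 : lift 1 0 = 0 :> 'I_2 by apply/val_inj.
rewrite (expand_det_row _ 0) !big_ord_recl big_ord0 /cofactor !det_mx11 !mxE.
by rewrite !l0 l1 /= expr0 expr1 mul1r mulN1r mulrN addr0.
Qed.

Section Characters.
Variable F : numClosedFieldType.

Lemma Zp_char_exists m : exists chi : 'I_m.+2 -> F,
  [/\ chi 0 = 1, forall x y, chi (x + y) = chi x * chi y &
      forall b, b != 0 -> exists i, chi (b * i) != 1].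
Proof.
have [z zP] := prim_root_exists F (ltn0Sn m.+1).
exists (fun x => z ^+ x); split=> // [x y | b b0].
  by rewrite /= (prim_expr_mod zP) exprD.
(* Here [1 : 'I_m.+2], so [b * 1] has the value of [b], less than the order of
   [z]. *)
exists 1; rewrite mulr1 -(prim_order_dvd zP) gtnNdvd //.
by rewrite lt0n; apply: contra b0 => /eqP b0; apply/eqP/val_inj.
Qed.

Lemma cyclic_square_tfp n : (0 < n)%N ->
  exists m f (rho : cyclic_square n -> 'M[F]_m), tracefree_projrep f rho.
Proof.
case: n => [//|[|n]] _.
  exists 1, (fun _ _ => 1), (fun=> 1%:M); split=> [x|x y|x|].
  - exact: unitmx1.
  - by rewrite mulmx1 scale1r.
  - by case: x => i j; rewrite !ord1 eqxx.
  - by rewrite card_prod card_ord.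
have [chi [chi0 chiD chi_nd]] := Zp_char_exists n.
exists #|'I_n.+2|, (heisenberg_cocycle chi fst snd 0).
exists (heisenberg chi fst snd 0).
apply: heisenberg_tfp => //.
- by case=> x1 x2 /= -> ->.
- by rewrite card_prod card_ord mulnn.
Qed.

(** With c = 1/2 the cocycle is [chi] of half the determinant of the two rows,
    so it is preserved by matrices of determinant 1. *)
Lemma symplectic_tfp q : prime q -> odd q ->
  exists m f (rho : 'rV['F_q]_2 -> 'M[F]_m), tracefree_projrep f rho /\
    forall S : 'M['F_q]_2, \det S = 1 ->
      forall x y, f (x *m S) (y *m S) = f x y.
Proof.
move=> q_pr q_odd.
have [chi [chi0 chiD chi_nd]] := Zp_char_exists (Zp_trunc (pdiv q)).
(* The ring 'F_q is convertible to 'I_(Zp_trunc (pdiv q)).+2. *)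
pose h : 'F_q := 2^-1.
exists #|'F_q|, (heisenberg_cocycle chi (fun x : 'rV['F_q]_2 => x 0 0)
                               (fun x : 'rV_2 => x 0 1) h).
exists (heisenberg chi (fun x : 'rV_2 => x 0 0) (fun x : 'rV_2 => x 0 1) h).
split.
  apply: heisenberg_tfp => //.
  - by move=> x y; rewrite !mxE.
  - by move=> x y; rewrite !mxE.
  - move=> x x0 x1; apply/rowP => i; rewrite mxE.
    by case: i => [[|[|//]] Hi]; [rewrite -[RHS]x0|rewrite -[RHS]x1];
      congr (x _ _); apply/val_inj.
  - by rewrite card_mx mul1n.
move=> S detS x y; rewrite /heisenberg_cocycle; congr (chi _).
have h2 : h * 2 = 1.
  rewrite mulVf // -(dvdn_pcharf (pchar_Fp q_pr)) //.
  by rewrite dvdn_prime2 //; apply: contraTneq q_odd => ->.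
have e (u v : 'rV['F_q]_2) : u 0 0 * v 0 1 - h * (u 0 0 * v 0 1 + u 0 1 * v 0 0)
   = h * (u 0 0 * v 0 1 - u 0 1 * v 0 0).
  rewrite -[X in X - _]mul1r -h2; ring.
rewrite !e; congr (_ * _); rewrite -[RHS]mul1r -detS det_mx22.
have l0 : lift 0 0 = 1 :> 'I_2 by apply/val_inj.
rewrite !mxE !big_ord_recl !big_ord0 !l0; ring.
Qed.
End Characters.

(** * A non-abelian group of order (p q)^2 *)

(** If p divides q - 1, a diagonal matrix diag (v, v^-1) works.  Otherwise an
    element of order p of GL_2(q), which exists because p divides q + 1, has
    a determinant whose order divides both p and q - 1. *)
Lemma SL2_elt_prime_order p q : prime p -> prime q ->
  (p %| q.-1)%N || (p %| q.+1)%N ->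
  exists S : 'M['F_q]_2, [/\ \det S = 1, S ^+ p = 1 & S != 1].
Proof.
move=> p_pr q_pr; have [pq1 _|npq1 /= pq1] := boolP (p %| q.-1)%N.
  have /Cauchy[//|a _ oa] : (p %| #|[set: {unit 'F_q}]|)%N.
    by rewrite card_finField_unit card_Fp.
  pose v : 'F_q := FinRing.uval a.
  have vp : v ^+ p = 1 by rewrite /v -FinRing.val_unitX -oa expg_order.
  have v_unit : v \is a GRing.unit by apply: (valP a).
  have v1 : v != 1.
    apply: contraTneq p_pr => v1; rewrite -oa (_ : a = 1%g) ?order1 //.
    exact/val_inj.
  pose d k : 'rV['F_q]_2 := \row_j (if j == 0 then v ^+ k else v ^- k).
  have dX k : diag_mx (d 1%N) ^+ k = diag_mx (d k).
    elim: k => [|k IHk].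
      rewrite expr0; apply/matrixP => i j; rewrite !mxE expr0 invr1.
      by case: ifP.
    rewrite exprS IHk; rewrite -[LHS]/(_ *m _) mulmx_diag; congr diag_mx.
    apply/rowP => j; rewrite !mxE expr1; case: ifP => _; first by rewrite exprS.
    by rewrite exprSr invrM ?unitrX.
  exists (diag_mx (d 1%N)); split.
  - by rewrite det_mx22 !mxE /= mulr0n mul0r subr0 !mulr1n divrr.
  - rewrite dX; apply/matrixP => i j; rewrite !mxE vp invr1.
    by case: ifP.
  - apply: contra v1 => /eqP/matrixP/(_ 0 0).
    by rewrite !mxE /= => /eqP.
have /Cauchy[//|S _ oS] : (p %| #|('GL_2['F_q])%g|)%N.
  by rewrite card_GL_2 card_Fp // dvdn_mull.
have Sp : (GLval S) ^+ p = 1 by rewrite -FinRing.val_unitX -oS expg_order.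
exists (GLval S); split=> //; last first.
  apply: contraTneq p_pr => S1; rewrite -oS (_ : S = 1%g) ?order1 //.
  exact/val_inj.
have dSX k : \det (GLval S ^+ k) = \det (GLval S) ^+ k.
  by elim: k => [|k IHk]; rewrite ?expr0 ?det1 // !exprS -IHk -det_mulmx.
have dSp : \det (GLval S) ^+ p = 1 by rewrite -dSX Sp det1.
have dSq : \det (GLval S) ^+ q.-1 = 1.
  apply: (mulfI (GL_det S)); rewrite -exprS mulr1 (prednK (prime_gt0 q_pr)).
  by have := expf_card (\det (GLval S) : 'F_q); rewrite card_Fp.
have co : coprime p q.-1 by rewrite prime_coprime.
have [u v e _] := egcdnP q.-1 (prime_gt0 p_pr).
move: (\det (GLval S)) (GL_det S) dSp dSq => d d0 dp dq.
rewrite -[LHS]expr1 -(eqP co); apply: (mulIf (expf_neq0 (v * q.-1) d0)).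
by rewrite -exprD addnC -e mulnC exprM dp expr1n mul1r mulnC exprM dq expr1n.
Qed.

(** Only the first factor of the acting group C_p x C_p acts, through the powers
    of [S]; the second factor is there because the p-part of a group of central
    type must itself carry a non-degenerate cocycle. *)
Section PowerAction.
Variables (p q : nat) (S : 'M['F_q]_2).
Hypothesis p_gt0 : (0 < p)%N.
Hypothesis Sp : S ^+ p = 1.

Definition pow_act (v : 'rV['F_q]_2) (k : cyclic_square p) : 'rV['F_q]_2 :=
  v *m S ^+ (k.1 : 'I_p.-1.+1).

Lemma pow_actM v a b : pow_act v (a * b)%g = pow_act (pow_act v a) b.
Proof.
rewrite /pow_act -mulmxA -[S ^+ _ *m _]/(S ^+ _ * S ^+ _) -exprD.
congr (_ *m _); have -> : (a * b)%g.1 = ((a.1 + b.1) %% p)%N :> nat.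
  by congr (_ %% _)%N; apply: prednK.
by rewrite expr_mod.
Qed.

Lemma pow_act1 v : pow_act v 1%g = v.
Proof. by rewrite /pow_act expr0 mulmx1. Qed.

Canonical pow_action := TotalAction pow_act1 pow_actM.

Lemma pow_act_is_groupAction : is_groupAction [set: 'rV['F_q]_2] pow_action.
Proof.
move=> a _; rewrite inE; apply/andP; split.
  by apply/subsetP => x; rewrite inE.
by apply/morphicP => x y _ _; rewrite !actpermE /= /pow_act mulmxDl.
Qed.

Definition pow_groupAction := GroupAction pow_act_is_groupAction.

Lemma card_sdprod_pow :
  #|sdprod_by pow_groupAction| = (#|cyclic_square p| * #|'rV['F_q]_2|)%N.
Proof.
rewrite card_sub -!cardsT -cardsX.
by apply: eq_card => x; rewrite !inE.
Qed.

Lemma pow_sdprod_nonabelian : (1 < p)%N -> S != 1 ->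
  ~~ abelian [set: sdprod_by pow_groupAction].
Proof.
move=> p1 S1; apply: contra S1 => /centsP ab.
apply/eqP/row_matrixP => i; rewrite row1 rowE.
(* This element acts by [S] itself, as 1 < p. *)
pose k : cyclic_square p := (inord 1, 1%g).
have e := sdpair_act pow_groupAction (in_setT (delta_mx 0 i)) (in_setT k).
have c : commute (sdpair1 pow_groupAction (delta_mx 0 i))
                 (sdpair2 pow_groupAction k) by apply: ab; rewrite inE.
have := conjgC (sdpair1 pow_groupAction (delta_mx 0 i))
               (sdpair2 pow_groupAction k).
rewrite -e c => /mulgI /(injmP (injm_sdpair1 pow_groupAction)).
rewrite !inE /= /pow_act /k /= inordK ?prednK // expr1 => H.
by rewrite -H ?inE.
Qed.
End PowerAction.

Lemma nonabelian_tfp (F : numClosedFieldType) p q :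
    prime p -> prime q -> odd q -> (p %| q.-1)%N || (p %| q.+1)%N ->
  exists gT : finGroupType, [/\ #|gT| = ((p * q) ^ 2)%N,
    ~~ abelian [set: gT] &
    exists m f (rho : gT -> 'M[F]_m), tracefree_projrep f rho].
Proof.
move=> p_pr q_pr q_odd pq.
have [S [detS Sp S1]] := SL2_elt_prime_order p_pr q_pr pq.
have p_gt0 := prime_gt0 p_pr.
have [m [f [rho [np fS]]]] := symplectic_tfp F q_pr q_odd.
have [l [g [tau npK]]] := cyclic_square_tfp F p_gt0.
pose to := pow_groupAction p_gt0 Sp; exists (sdprod_by to); split.
- rewrite card_sdprod_pow card_prod card_mx card_Fp // !card_ord prednK //.
  by rewrite mul1n mulnn expnMn.
- by apply: pow_sdprod_nonabelian; rewrite ?prime_gt1.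
exists (m * l)%N; apply: (@tfp_semidirect _ (sdprod_by to) _ _
  (fun x => x.1) (fun x => x.2) (fun k v => to v k)
  _ _ _ _ _ _ _ _ _ _ _ _ _ npK np) => //.
- by move=> [[a x] /= ?] /= a1 x1; apply/val_inj; rewrite /= a1 x1.
- exact: card_sdprod_pow.
- by move=> a x y; rewrite /= /pow_act mulmxDl.
- by move=> a b x; rewrite /= pow_actM.
- by move=> x; rewrite /= pow_act1.
- move=> a x y; rewrite /= /pow_act fS //.
  elim: (nat_of_ord _) => [|k IHk]; first by rewrite expr0 det1.
  by rewrite exprS -[_ * _]/(_ *m _) det_mulmx detS mul1r.
Qed.

(** * Transfer and a criterion for commutativity *)

Section Burnside.
Import FiniteModule.
Local Open Scope group_scope.
Variables (gT : finGroupType) (p : nat) (G S : {group gT}).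
Hypothesis sylS : p.-Sylow(G) S.
Hypothesis cNS : 'N_G(S) \subset 'C(S).

Let sSG : S \subset G := pHall_sub sylS.
Let abS : abelian S.
Proof. by apply: subset_trans cNS; rewrite subsetI sSG normG. Qed.

(** Both S and S^g are Sylow subgroups of the centraliser of x^g, so g can be
    corrected by an element of that centraliser to normalise S. *)
Lemma Burnside_fusion x g : x \in S -> g \in G -> x ^ g \in S -> x ^ g = x.
Proof.
move=> Sx Gg Sxg; pose C := 'C_G[x ^ g].
have sSC : S \subset C.
  by rewrite subsetI sSG sub_cent1 (subsetP abS).
have sSgC : S :^ g \subset C.
  by rewrite subsetI conj_subG // sub_cent1 centJ memJ_conjg (subsetP abS).
have sCG : C \subset G by apply: subsetIl.
have sylSC : p.-Sylow(C) S := pHall_subl sSC sCG sylS.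
have sylSgC : p.-Sylow(C) (S :^ g).
  by apply: pHall_subl sSgC sCG _; rewrite pHallJ.
have [c Cc eSc] := Sylow_trans sylSC sylSgC.
have [Gc cxc] := setIP Cc.
have Nh : g * c^-1 \in 'N_G(S).
  rewrite inE groupM ?groupV //=; apply/normP; rewrite conjsgM /= eSc.
  by rewrite conjsgK.
have /commute_sym/commgP/conjg_fixP := centP (subsetP cNS _ Nh) x Sx.
rewrite conjgM => {2}<-; apply/esym/conjg_fixP/commgP.
by apply: commuteV; apply: commute_sym; apply/cent1P.
Qed.

(** By fusion, the transfer of an element g of S into S is a product of powers
    of g with total exponent the index of S, which is prime to p.  So the kernel
    of the transfer meets S trivially, and this kernel contains the derived
    subgroup. *)
Lemma Burnside_der1 : p^'.-group G^`(1).
Proof.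
have abA : abelian (idm_morphism S @* S) by rewrite morphim_idm.
have inA x : x \in S -> x \in (idm_morphism S @* S)%G.
  by move=> Sx; rewrite /= morphim_idm.
pose V := transfer_morphism G abA.
have sDK : G^`(1) \subset 'ker V.
  rewrite gen_subG; apply/subsetP => _ /imset2P[x y Gx Gy ->].
  apply/kerP; first by rewrite groupR.
  rewrite morphR //; apply/eqP/commgP.
  by rewrite /commute !FinRing.zmodMgE GRing.addrC.
have KS : S :&: 'ker V = 1.
  apply/trivgP/subsetP => g /setIP[Sg kerg]; rewrite inE.
  have Gg := subsetP sSG g Sg.
  pose X := transversal (rcosets S G :* <[g]>) G.
  have trX : is_transversal X (rcosets S G :* <[g]>) G.
    by apply: transversalP; apply: rcosets_cycle_partition.
  have := mker kerg; rewrite /= (transfer_cycle_expansion sSG abA Gg trX).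
  rewrite (eq_bigr (fun x => fmod abA g *+ #|<[g]> : S :* x|)%R) => [|x Xx].
    rewrite GRing.sumrMnr (sum_index_rcosets_cycle sSG Gg trX).
    rewrite -fmodX ?inA // => /(congr1 val).
    rewrite fmodK ?inA ?groupX // => /= e.
    have co : coprime #|S| #|G : S|.
      by case/and3P: sylS => _ pS p'i; apply: pnat_coprime pS p'i.
    by rewrite -(expgK co Sg) e expg1n.
  have Gx : x \in G := subsetP (transversal_sub trX) x Xx.
  have gS : (g ^+ #|<[g]> : S :* x|) ^ x^-1 \in S.
    by rewrite conjgE invgK mulgA -mem_rcoset mulg_exp_card_rcosets.
  transitivity (fmod abA ((g ^+ #|<[g]> : S :* x|) ^ x^-1)) => //.
  rewrite -fmodX ?inA //; congr (fmod _ _).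
  by apply: Burnside_fusion; rewrite ?groupX ?groupV.
have sylK : p.-Sylow('ker V) (S :&: 'ker V).
  exact: Hall_setI_normal (ker_normal V) sylS.
by apply: pgroupS sDK _; rewrite -partG_eq1 -(card_Hall sylK) /= KS cards1.
Qed.
End Burnside.

Section ArithmeticAbelian.
Local Open Scope group_scope.

(** The number of fixed points of Q on S is 1, p or p^2, and it is congruent to
    p^2 modulo q.  Since p^2 - 1 = (p - 1) (p + 1) and p^2 - p = p (p - 1) are
    prime to q, only p^2 remains. *)
Lemma card_p2_centralised (gT : finGroupType) (S Q : {group gT}) p q :
    prime p -> prime q -> #|S| = (p ^ 2)%N -> q.-group Q -> Q \subset 'N(S) ->
    p != q -> ~~ (q %| p.-1)%N -> ~~ (q %| p.+1)%N ->
  Q \subset 'C(S).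
Proof.
move=> p_pr q_pr cardS qQ nSQ npq nq1 nq2; rewrite centsC.
have : [acts Q, on S | 'J] by rewrite /acts_on astabsJ.
move/(pgroup_fix_mod qQ); rewrite afixJ => mod_q.
suff eC : 'C_S(Q) = S by rewrite -eC subsetIr.
apply/eqP; rewrite eqEcard subsetIl /= cardS.
have /(dvdn_pfactor _ _ p_pr)[k k2 ek] : (#|'C_S(Q)%g| %| p ^ 2)%N.
  by rewrite -cardS cardSg // subsetIl.
rewrite ek in mod_q *; rewrite (leq_exp2l _ _ (prime_gt1 p_pr)) leqNgt.
apply/negP => k_lt2.
move: mod_q; rewrite cardS => /eqP; rewrite eqn_mod_dvd; last first.
  by rewrite (leq_exp2l _ _ (prime_gt1 p_pr)).
have p_gt0 := prime_gt0 p_pr; apply/negP.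
case: k k_lt2 {k2 ek} => [|[|]] // _.
  rewrite expn0 -(exp1n 2) subn_sqr subn1 addn1 Euclid_dvdM //.
  by rewrite (negPf nq1) (negPf nq2).
rewrite -(mulnn p) expn1 -[X in (_ - X)%N]muln1 -mulnBr subn1 Euclid_dvdM //.
by rewrite (negPf nq1) orbF dvdn_prime2 // eq_sym (negPf npq).
Qed.

(** The normaliser of a Sylow subgroup S is generated by its own Sylow
    subgroups: one is S, which is abelian as its order is the square of a prime,
    and the others centralise S by the counting argument.  Transfer then
    shows that no prime divides the order of the derived subgroup. *)
Lemma arith_abelian (gT : finGroupType) (G : {group gT}) :
    (forall p, prime p -> (p %| #|G|)%N -> logn p #|G| = 2) ->
    (forall p q, prime p -> prime q -> (p %| #|G|)%N -> (q %| #|G|)%N ->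
       ~~ (q %| p.-1)%N && ~~ (q %| p.+1)%N) ->
  abelian G.
Proof.
move=> cubefree nocong; apply/derG1P/eqP; rewrite trivg_card1.
apply/negPn/negP => G'1.
have [p p_pr pG'] : exists2 p, prime p & (p %| #|G^`(1)%g|)%N.
  exists (pdiv #|G^`(1)|); last exact: pdiv_dvd.
  by rewrite pdiv_prime // ltn_neqAle eq_sym G'1 cardG_gt0.
have pG : (p %| #|G|)%N by apply: dvdn_trans pG' (cardSg (der_sub 1 G)).
have [S sylS] := Sylow_exists p G.
have cardS : #|S| = (p ^ 2)%N by rewrite (card_Hall sylS) p_part cubefree.
have sSG := pHall_sub sylS.
suff cNS : 'N_G(S) \subset 'C(S).
  by have := Burnside_der1 sylS cNS; rewrite /pgroup p'natE // pG'.
rewrite -(Sylow_gen 'N_G(S)) gen_subG.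
apply/bigcupsP => Q /SylowP[q q_pr /and3P[]].
rewrite subsetI => /andP[sQG nSQ] qQ _.
have [eqp|nqp] := eqVneq p q; last first.
  have [->|ntQ] := eqVneq Q 1%G; first exact: sub1G.
  have [_ qdQ _] := pgroup_pdiv qQ ntQ.
  have qG : (q %| #|G|)%N := dvdn_trans qdQ (cardSg sQG).
  have /andP[n1 n2] := nocong p q p_pr q_pr pG qG.
  exact: card_p2_centralised cardS qQ nSQ nqp n1 n2.
have abS : abelian S by apply: card_p2group_abelian p_pr cardS.
apply: subset_trans abS.
rewrite -eqp in qQ.
have sylN : p.-Sylow('N_G(S)) S.
  by apply: pHall_subl sylS; rewrite ?subsetIl // subsetI sSG normG.
rewrite (sub_normal_Hall sylN) // ?subsetI ?sQG //.
by rewrite /normal subsetI sSG normG subsetIr.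
Qed.
End ArithmeticAbelian.

(** * Cocycles on abelian groups *)

(** The basis element of x is central, hence a scalar multiple of 1, which is a
    multiple of the basis element of the identity. *)
Lemma nondegenerate_center (F : fieldType) (gT : finGroupType)
    (f : cocycle2 F gT) (x : gT) :
    nondegenerate_cocycle f ->
    (forall y, f x y = f y x /\ commute x y) -> x = 1%g.
Proof.
case=> m [phi /[dup] phi_bij [psi phiK psiK]] cx.
have cB A : A *m phi (tga_basis f x) = phi (tga_basis f x) *m A.
  rewrite -[A]psiK -[LHS]/(_ * _) -[RHS]/(_ * _) -!rmorphM; congr (phi _).
  rewrite [psi A](tga_sum_basis (f := f)) mulr_suml mulr_sumr.
  apply: eq_bigr => y _; rewrite -scalerAl -scalerAr !tga_basisM.
  by have [-> ->] := cx y.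
have [c phix] := mx_central_scalar cB.
have : tga_basis f x = c *: 1.
  by apply: (bij_inj phi_bij); rewrite linearZ rmorph1 phix -scalemx1.
move=> /ffunP/(_ x); rewrite !ffunE eqxx.
case: eqP => // _ /eqP; rewrite -[X in _ == X]/(c * (_ * 0)) !mulr0.
by rewrite oner_eq0.
Qed.

Section CommutatorPairing.
Variables (F : fieldType) (gT : finGroupType) (f : cocycle2 F gT).
Hypothesis abT : abelian [set: gT].

Let mulgCT (x y : gT) : (x * y = y * x)%g.
Proof. by apply: (centsP abT); rewrite inE. Qed.

Definition comm_pairing x y := f x y / f y x.

Lemma comm_pairingV x y : comm_pairing y x = (comm_pairing x y)^-1.
Proof. by rewrite /comm_pairing invfM invrK mulrC. Qed.

(** Three instances of the cocycle identity, for (x, y, z) and two of its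
    permutations, combined after clearing denominators. *)
Lemma comm_pairingM x y z :
  comm_pairing x (y * z)%g = comm_pairing x y * comm_pairing x z.
Proof.
have nz := cocycle2_neq0 f.
have e1 := cocycle2P f x y z; have e2 := cocycle2P f y z x.
have e3 := cocycle2P f y x z; rewrite (mulgCT y x) in e3.
rewrite (mulgCT z x) in e2.
(* The two multipliers are the factors that [e1] and [e3] consume. *)
rewrite /comm_pairing mulf_div; apply/eqP; rewrite eqr_div ?mulf_neq0 ?nz //.
apply/eqP; apply: (mulfI (nz y z)); apply: (mulfI (nz (x * y)%g z)).
transitivity (f y z * f x (y * z)%g * (f y x * f (x * y)%g z) * f z x).
  by ring.
rewrite -e1 e3.
transitivity (f x y * f x z * (f y z * f (y * z)%g x) * f (x * y)%g z).
  by rewrite e2; ring.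
by ring.
Qed.

Lemma comm_pairing1 x : comm_pairing x 1%g = 1.
Proof.
apply: (mulfI (_ : comm_pairing x 1%g != 0)).
  by rewrite mulf_neq0 ?invr_eq0 ?cocycle2_neq0.
by rewrite -comm_pairingM mulg1 mulr1.
Qed.

Lemma comm_pairingX x y k : comm_pairing x (y ^+ k)%g = comm_pairing x y ^+ k.
Proof.
elim: k => [|k IHk]; first by rewrite expg0 comm_pairing1 expr0.
by rewrite expgS comm_pairingM IHk exprS.
Qed.

(** The pairing of x with the pi-part of y is trivial because this part is a
    power of x; its pairing with the pi'-part is a root of unity of two coprime
    orders.  So x lies in the radical of the pairing. *)
Lemma nondegenerate_cyclic_Hall pi (x : gT) :
  nondegenerate_cocycle f -> (pi.-Hall([set: gT]) <[x]>)%g -> x = 1%g.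
Proof.
move=> nd hallx; apply: (nondegenerate_center nd) => y.
split; last exact: mulgCT.
suff e : comm_pairing x y = 1.
  by rewrite -[LHS](divfK (cocycle2_neq0 f y x)) -/(comm_pairing x y) e mul1r.
have nx : (<[x]> <| [set: gT])%g by rewrite -sub_abelian_normal ?subsetT.
rewrite -(consttC pi y) comm_pairingM.
have : (y.`_pi \in <[x]>)%g.
  by rewrite (mem_normal_Hall hallx nx) ?inE ?p_elt_constt.
case/cycleP=> i ->; rewrite comm_pairingX {1}/comm_pairing divff //; last first.
  exact: cocycle2_neq0.
rewrite expr1n mul1r; set z := (y.`_pi^')%g.
have zz : comm_pairing x z ^+ #[z]%g = 1.
  by rewrite -comm_pairingX expg_order comm_pairing1.
have zx : comm_pairing x z ^+ #[x]%g = 1.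
  rewrite comm_pairingV exprVn -comm_pairingX expg_order comm_pairing1.
  by rewrite invr1.
have co : coprime #[x]%g #[z]%g.
  apply: (pnat_coprime (pi := pi)); first exact: (pHall_pgroup hallx).
  exact: p_elt_constt.
have [u v e _] := egcdnP #[z]%g (order_gt0 x).
have nz : comm_pairing x z != 0.
  by rewrite mulf_neq0 ?invr_eq0 ?cocycle2_neq0.
rewrite -[LHS]expr1 -(eqP co); apply: (mulfI (expf_neq0 (v * #[z]%g) nz)).
by rewrite -exprD -e mulr1 mulnC exprM zx expr1n mulnC exprM zz expr1n.
Qed.

End CommutatorPairing.

(** * Abelian groups of square-free exponent *)

Definition square_free n := forall p, prime p -> (p %| n)%N -> logn p n = 1%N.

(** The congruences of [q] with 1 and -1 modulo [p], as divisibilities. *)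
Definition no_pm1_congruence n := forall p q, prime p -> prime q ->
  (p %| n)%N -> (q %| n)%N -> ~~ (p %| q.-1)%N && ~~ (p %| q.+1)%N.

Section SquareFree.
Local Open Scope nat_scope.
Variable n : nat.
Hypotheses (n_gt0 : 0 < n) (n_sf : square_free n).

Lemma square_free_dvd b :
  (forall p, prime p -> p %| n -> p %| b) -> n %| b.
Proof.
move=> nb; apply/dvdn_partP => // p; rewrite mem_primes => /and3P[p_pr _ pn].
by rewrite p_part n_sf // nb.
Qed.

(** Each invariant factor divides n and their product is n^2.  A prime p
    dividing n divides the second factor b: otherwise it would divide none of
    the later ones either, and p^2 would divide the first.  So the first two
    factors equal n and leave no room for others. *)
Lemma square_free_type (gT : finGroupType) (G : {group gT}) :
    abelian G -> #|G| = n ^ 2 -> exponent G %| n ->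
  abelian_type G = if n == 1 then [::] else [:: n; n].
Proof.
move=> abG cardG expG; have [bG defG def_t] := abelian_structure abG.
have := abelian_type_gt1 G; have := abelian_type_dvdn_sorted G.
have : all (fun m => m %| n) (abelian_type G).
  rewrite -def_t; apply/allP => _ /mapP[x bx ->].
  apply: dvdn_trans expG; apply: dvdn_exponent.
  by rewrite -cycle_subG -(bigdprodWY defG) sub_gen // (big_rem x bx) subsetUl.
have : \prod_(m <- abelian_type G) m = n ^ 2.
  by rewrite -def_t big_map -cardG -(bigdprod_card defG).
case: (abelian_type G) => [|a [|b r]].
- by rewrite big_nil => /esym/eqP; rewrite -(exp1n 2) eqn_exp2r // => ->.
- rewrite big_seq1 /= => -> /andP[nn _] _ /andP[n1 _]; exfalso.
  have := dvdn_leq n_gt0 nn; rewrite leqNgt -{1}(expn1 n) ltn_exp2l //.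
  by case: n n_gt0 n1 => [|[]].
rewrite !big_cons /= => prod_t /and3P[an bn rn] /andP[ba bs] /and3P[a1 b1 r1].
have nb : n %| b.
  apply: square_free_dvd => p p_pr pn; apply/negPn/negP => npb.
  have rb : all (fun m => m %| b) r.
    by apply: order_path_min bs => x y z /= yx xz; apply: dvdn_trans xz yx.
  have npr : ~~ (p %| b * \prod_(m <- r) m).
    rewrite Euclid_dvdM // (negPf npb) /= big_seq.
    elim/big_rec: _ => [|m x mr npx]; first by rewrite dvdn1 gtn_eqF ?prime_gt1.
    rewrite Euclid_dvdM // (negPf npx) orbF; apply: contra npb => pm.
    exact: dvdn_trans pm (allP rb m mr).
  have : p ^ 2 %| a * (b * \prod_(m <- r) m) by rewrite prod_t dvdn_exp2r.
  rewrite Gauss_dvdl ?coprimeXl ?prime_coprime // => pa.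
  by have := dvdn_trans pa an; rewrite pfactor_dvdn // n_sf.
have bE : b = n by apply/eqP; rewrite eqn_dvd bn nb.
have aE : a = n by apply/eqP; rewrite eqn_dvd an -{1}bE ba.
have n1 : 1 < n by rewrite -bE.
rewrite gtn_eqF // aE bE; congr [:: _, _ & _].
move: prod_t; rewrite aE bE mulnA mulnn -[RHS]muln1 => /eqP.
rewrite eqn_pmul2l ?expn_gt0 ?n_gt0 //.
case: r r1 {rn bs} => //= c r /andP[c1 _].
by rewrite big_cons muln_eq1 gtn_eqF.
Qed.

Lemma square_free_isog (gT hT : finGroupType) :
    abelian [set: gT] -> abelian [set: hT] ->
    #|gT| = n ^ 2 -> #|hT| = n ^ 2 ->
    (forall x : gT, x ^+ n = 1)%g -> (forall x : hT, x ^+ n = 1)%g ->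
  ([set: gT] \isog [set: hT])%g.
Proof.
move=> abG abH cG cH eG eH; rewrite eq_abelian_type_isog //.
by rewrite !square_free_type ?cardsT //; apply/exponentP => x _.
Qed.

End SquareFree.

(** * Uniqueness of the group of central type *)

Section CyclicSquare.
Local Open Scope group_scope.

Lemma pairX (gT hT : finGroupType) (x : (gT * hT)%type) k :
  x ^+ k = (x.1 ^+ k, x.2 ^+ k).
Proof. by elim: k => [|k IHk]; rewrite ?expg0 // !expgS IHk. Qed.

Lemma cyclic_square_expg n (x : cyclic_square n) : (0 < n)%N -> x ^+ n = 1.
Proof.
move=> n_gt0; have e (y : cyclic_group n) : y ^+ n = 1.
  have := expg_cardG (in_setT y).
  by rewrite cardsT card_ord (prednK n_gt0).
by rewrite pairX !e.
Qed.

Lemma cyclic_square_order n : (0 < n)%N -> exists x : cyclic_square n,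
  forall k, x ^+ k = 1 -> (n %| k)%N.
Proof.
case: n => // n _; exists (Zp1, 1) => k; rewrite pairX => -[/eqP].
by rewrite -order_dvdn order_Zp1.
Qed.

Lemma cyclic_square_abelian n : abelian [set: cyclic_square n].
Proof.
apply/centsP => -[x1 x2] _ [y1 y2] _.
by congr (_, _); apply: Zp_addC.
Qed.

Lemma card_cyclic_square n : (0 < n)%N -> #|cyclic_square n| = (n ^ 2)%N.
Proof. by move=> n_gt0; rewrite card_prod !card_ord prednK // mulnn. Qed.

End CyclicSquare.

Lemma cyclic_square_central_type (R : realType) n :
  (0 < n)%N -> central_type R (cyclic_square n).
Proof.
move=> n_gt0.
have [m [f [rho np]]] := cyclic_square_tfp (complex R) n_gt0.
exact: tfp_central_type np.
Qed.

Section Uniqueness.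
Variables (R : realType) (n : nat).
Hypothesis n_gt0 : (0 < n)%N.

(** An element y of order p^2 would generate a cyclic Sylow subgroup, so every
    element has square-free order, dividing n. *)
Lemma central_type_isog_cyclic_square (gT : finGroupType) :
    square_free n -> no_pm1_congruence n -> #|gT| = (n ^ 2)%N ->
  central_type R gT -> ([set: gT] \isog [set: cyclic_square n])%g.
Proof.
move=> n_sf n_nc cardG [f nd].
have prG p : prime p -> (p %| #|[set: gT]|)%N -> (p %| n)%N.
  by move=> p_pr; rewrite cardsT cardG Euclid_dvdX // => /andP[].
have lognG p : prime p -> (p %| n)%N -> logn p #|[set: gT]| = 2%N.
  by move=> p_pr pn; rewrite cardsT cardG lognX n_sf.
have abG : abelian [set: gT].
  apply: arith_abelian => [p p_pr pG | p q p_pr q_pr pG qG].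
    by apply: lognG => //; apply: prG.
  by apply: n_nc => //; apply: prG.
apply: (square_free_isog n_gt0 n_sf) => //; first exact: cyclic_square_abelian.
- exact: card_cyclic_square.
- move=> x; apply/eqP; rewrite -order_dvdn; apply/dvdn_partP.
    exact: order_gt0.
  move=> p; rewrite mem_primes => /and3P[p_pr _ px].
  have pn : (p %| n)%N.
    by apply: prG => //; apply: dvdn_trans px (order_dvdG (in_setT x)).
  rewrite p_part; suff k1 : (logn p #[x]%g <= 1)%N.
    by apply: dvdn_trans (dvdn_exp2l p k1) _; rewrite expn1.
  rewrite leqNgt; apply/negP => k2.
  have ke : logn p #[x]%g = 2%N.
    apply/eqP; rewrite eqn_leq k2 andbT -(lognG p p_pr pn).
    by rewrite dvdn_leq_log ?cardG_gt0 // order_dvdG ?inE.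
  have oy : #[(x.`_p)%g]%g = (p ^ 2)%N by rewrite order_constt p_part ke.
  suff y1 : (x.`_p = 1)%g.
    by have := prime_gt1 p_pr; move: oy; rewrite y1 order1; case: (p) => [|[|]].
  apply: (nondegenerate_cyclic_Hall abG (pi := p) nd).
  by rewrite pHallE subsetT /= -/(#[_])%g oy p_part lognG.
- by move=> x; apply: cyclic_square_expg.
Qed.

Hypothesis uniq : forall gT : finGroupType, #|gT| = (n ^ 2)%N ->
  central_type R gT -> ([set: gT] \isog [set: cyclic_square n])%g.

(** If p^2 divides n, the direct product of the squares of C_p and C_(n/p) is of
    central type and has exponent n/p. *)
Lemma unique_square_free : square_free n.
Proof.
move=> p p_pr pn; apply/eqP; rewrite eqn_leq -pfactor_dvdn // expn1 pn andbT.
rewrite leqNgt; apply/negP => lp.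
have p2n : (p ^ 2 %| n)%N by rewrite pfactor_dvdn.
have p_gt0 := prime_gt0 p_pr.
pose m := (n %/ p)%N; have nE : n = (p * m)%N by rewrite mulnC divnK.
have m_gt0 : (0 < m)%N by move: n_gt0; rewrite nE muln_gt0 => /andP[].
have pm : (p %| m)%N by rewrite -(dvdn_pmul2l p_gt0) mulnn -nE.
have [l1 [f1 [rho1 np1]]] := cyclic_square_tfp (complex R) p_gt0.
have [l2 [f2 [rho2 np2]]] := cyclic_square_tfp (complex R) m_gt0.
have [f [rho np]] := tfp_prod np1 np2.
have := uniq _ (tfp_central_type np).
rewrite card_prod !card_cyclic_square // -expnMn -nE => /(_ erefl) iso.
have [x xP] := cyclic_square_order n_gt0.
have em : (exponent [set: (cyclic_square p * cyclic_square m)%type] %| m)%N.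
  apply/exponentP => -[y z] _; rewrite pairX /= cyclic_square_expg //.
  have [k ->] := dvdnP pm; rewrite mulnC expgM cyclic_square_expg //.
  by rewrite expg1n.
rewrite (exponent_isog iso) in em.
have /xP/(dvdn_leq m_gt0) : (x ^+ m)%g = 1%g.
  by apply: (exponentP em); rewrite inE.
by rewrite leqNgt nE -{1}[m]mul1n ltn_pmul2r // prime_gt1.
Qed.

Lemma unique_no_pm1_congruence : no_pm1_congruence n.
Proof.
have odd_case p q : prime p -> prime q -> (p %| n)%N -> (q %| n)%N ->
    odd q -> (p %| q.-1)%N || (p %| q.+1)%N -> False.
  move=> p_pr q_pr pn qn q_odd pq.
  have npq : p != q.
    apply: contraTneq pq => ->; rewrite -addn1 dvdn_addr // dvdn1.
    rewrite negb_or gtn_eqF ?prime_gt1 // andbT gtnNdvd //.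
      by rewrite -subn1 subn_gt0 prime_gt1.
    by rewrite prednK ?prime_gt0.
  have [G0 [cG0 naG0 [l1 [f1 [rho1 np1]]]]] :=
    nonabelian_tfp (complex R) p_pr q_pr q_odd pq.
  have pqn : (p * q %| n)%N.
    by rewrite Gauss_dvd ?pn ?qn // prime_coprime // dvdn_prime2.
  have pq_gt0 : (0 < p * q)%N by rewrite muln_gt0 !prime_gt0.
  pose m := (n %/ (p * q))%N.
  have nE : n = (p * q * m)%N by rewrite mulnC divnK.
  have m_gt0 : (0 < m)%N by move: n_gt0; rewrite nE muln_gt0 => /andP[].
  have [l2 [f2 [rho2 np2]]] := cyclic_square_tfp (complex R) m_gt0.
  have [f [rho np]] := tfp_prod np1 np2.
  have := uniq _ (tfp_central_type np).
  rewrite card_prod cG0 card_cyclic_square // -expnMn -nE => /(_ erefl) iso.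
  have := cyclic_square_abelian n; rewrite -(isog_abelian iso) => /centsP ab.
  case/negP: naG0; apply/centsP => x _ y _.
  have [] := ab (x, 1%g) (in_setT _) (y, 1%g) (in_setT _).
  by [].
move=> p q p_pr q_pr pn qn; rewrite -negb_or; apply/negP => pq.
(* For q = 2 the prime p divides 1 or 3, and then 2 divides 3 - 1. *)
have [q2|q_odd] := even_prime q_pr; last exact: (odd_case p q).
move: pq; rewrite q2 /= dvdn1 => /orP[/eqP p1|]; first by rewrite p1 in p_pr.
rewrite dvdn_prime2 // => /eqP p3.
by subst p q; apply: (odd_case 2%N 3%N).
Qed.

End Uniqueness.

Lemma prime_product_logn (r : nat) (p k : 'I_r -> nat) n :
    (forall i, prime (p i)) -> injective p -> (forall i, 0 < k i)%N ->
    n = (\prod_(i < r) p i ^ k i)%N ->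
  [/\ (0 < n)%N, forall i, (p i %| n)%N, forall i, logn (p i) n = k i
    & forall q, prime q -> (q %| n)%N -> exists i, q = p i].
Proof.
move=> p_pr p_inj k_gt0 ->; split.
- by rewrite prodn_gt0 // => i; rewrite expn_gt0 prime_gt0.
- by move=> i; rewrite (bigD1 i) //= dvdn_mulr // dvdn_exp.
- move=> i; rewrite (bigD1 i) //= lognM ?expn_gt0 ?(prime_gt0 (p_pr i)) //;
    last first.
    by rewrite prodn_cond_gt0 // => j _; rewrite expn_gt0 prime_gt0.
  rewrite pfactorK // logn_coprime ?addn0 //.
  elim/big_rec: _ => [|j x ji cx]; first exact: coprimen1.
  rewrite coprimeMr cx andbT coprimeXr // prime_coprime // dvdn_prime2 //.
  by rewrite (inj_eq p_inj) eq_sym.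
- move=> q q_pr; rewrite Euclid_dvd_prod // big_has => /hasP[i _].
  by rewrite Euclid_dvdX // dvdn_prime2 // => /andP[/eqP -> _]; exists i.
Qed.

Lemma modz_eq1P (p q : nat) : (0 < q)%N ->
  (q%:Z = 1 %[mod p%:Z])%Z <-> (p %| q.-1)%N.
Proof.
move=> q_gt0; have e : q%:Z - 1 = q.-1%:Z.
  by rewrite -[in LHS](prednK q_gt0) -addn1 PoszD addrK.
by split=> [/eqP|pq]; [|apply/eqP]; rewrite eqz_mod_dvd e.
Qed.

Lemma modz_eqN1P (p q : nat) :
  (q%:Z = -1 %[mod p%:Z])%Z <-> (p %| q.+1)%N.
Proof.
have e : q%:Z - -1 = q.+1%:Z by rewrite opprK -addn1 PoszD.
by split=> [/eqP|pq]; [|apply/eqP]; rewrite eqz_mod_dvd e.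
Qed.

Theorem corollaryB (R : realType) (n r : nat) (p k : 'I_r -> nat)
    (p_prime : forall i, prime (p i)) (p_inj : injective p)
    (k_gt0 : forall i, (0 < k i)%N)
    (n_def : n = (\prod_(i < r) p i ^ k i)%N) :
  (central_type R (cyclic_square n) /\
   forall gT : finGroupType, #|gT| = (n ^ 2)%N -> central_type R gT ->
     ([set: gT] \isog [set: cyclic_square n])%g)
  <->
  ((forall i, k i = 1%N) /\
   forall i j, ~ ((p j)%:Z = 1 %[mod (p i)%:Z])%Z /\
               ~ ((p j)%:Z = -1 %[mod (p i)%:Z])%Z).
Proof.
have [n_gt0 pn logp n_p] := prime_product_logn p_prime p_inj k_gt0 n_def.
split=> [[_ uniq] | [k1 nc]].
  split=> [i | i j].
    by rewrite -logp; apply: (unique_square_free n_gt0 uniq).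
  have /andP[/negP n1 /negP n2] :=
    unique_no_pm1_congruence n_gt0 uniq (p_prime i) (p_prime j) (pn i) (pn j).
  split; first by move/(modz_eq1P _ (prime_gt0 (p_prime j))).
  by move/modz_eqN1P.
split=> [|gT]; first exact: cyclic_square_central_type.
apply: central_type_isog_cyclic_square => // [q q_pr /(n_p q q_pr)[i ->] | ].
  by rewrite logp k1.
move=> q1 q2 pr1 pr2 /(n_p q1 pr1)[i ->] /(n_p q2 pr2)[j ->].
have [n1 n2] := nc i j; apply/andP; split; apply/negP.
  by move/(modz_eq1P _ (prime_gt0 (p_prime j))).
by move/modz_eqN1P.
Qed.
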